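(* Every Hausdorff Cauchy completty quasitopological group $G$ is $H$-closed in the class of Hausdorff quasitopological groups; that is, $G$ is a closed subset of every Hausdorff quasitopological group $H$ which contains $G$ as a subgroup (algebraically, and with the topology of $G$ equal to the subspace topology inherited from $H$).
   Context: A quasitopological group is a group endowed with a topology such that the group operation is separately continuous and the inversion $x\mapsto x^{-1}$ is continuous. A filter $\mathcal F$ on a quasitopological group $G$ is called a Cauchy filter if for each neighbourhood $U$ of the unit $e$ of $G$ there exists a member $F\in\mathcal F$ such that $yU\cap Uy\in\mathcal F$ for each point $y\in F$. A quasitopological group $G$ is called Cauchy completty if each Cauchy filter $\mathcal F$ on $G$ that has a base consisting of open subsets of $G$ has a limit point in $G$, where a limit point of $\mathcal F$ is a point $x\in G$ belonging to the closure of every member of $\mathcal F$ (i.e. a cluster point of $\mathcal F$). *)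

(* Defs.v *)
From HB Require Import structures.
From mathcomp Require Import all_boot.
From mathcomp Require Import boolp classical_sets functions filter.
From mathcomp Require Import topology.

Set Implicit Arguments.
Unset Strict Implicit.
Unset Printing Implicit Defensive.

Local Open Scope classical_set_scope.
Local Open Scope group_scope.

(* No compatibility between the group law and a uniform structure is assumed,
   and the multiplication need not be jointly continuous. *)
HB.mixin Record Group_Topological_isQuasitopological G
    of Group G & Topological G := {
  mulg_continuousl : forall x : G, continuous (fun y : G => x * y);
  mulg_continuousr : forall x : G, continuous (fun y : G => y * x);
  invg_continuous : continuous (fun x : G => x^-1)
}.

#[short(type="quasitopGroupType")]
HB.structure Definition QuasitopologicalGroup :=
  {G of Group_Topological_isQuasitopological G & Group G & Topological G}.

Section Completty.
Variable G : quasitopGroupType.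

(* The uniformity-free notion: distinct from [cauchy] of uniform spaces. *)
Definition group_cauchy (F : set_system G) : Prop :=
  forall U : set G, nbhs (1 : G) U ->
    exists2 A : set G, F A &
      forall y : G, A y -> F ([set y * u | u in U] `&` [set u * y | u in U]).

Definition has_open_base (F : set_system G) : Prop :=
  exists2 B : set_system G,
    (forall O : set G, B O -> open O) & F = filter_from B id.

(* Filters are proper; [cluster F] is the intersection of the closures of the
   members of [F] (lemma [clusterE]). *)
Definition cauchy_completty : Prop :=
  forall F : set_system G, ProperFilter F -> group_cauchy F ->
    has_open_base F -> exists x : G, cluster F x.

End Completty.

(* [G] is identified through [f] with the subgroup [range f] of [H], and its
   topology with the subspace topology. *)
Definition subgroup_embedding (G H : quasitopGroupType)
    (f : {multiplicative G -> H}) : Prop :=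
  injective f /\
  forall A : set G, open A <-> exists2 B : set H, open B & A = f @^-1` B.

Definition h_closed_in (C : quasitopGroupType -> Prop)
    (G : quasitopGroupType) : Prop :=
  forall (H : quasitopGroupType) (f : {multiplicative G -> H}),
    C H -> subgroup_embedding f -> closed (range f).

(* Main.v *)
Require Import Defs.
From mathcomp Require Import all_boot.
From mathcomp Require Import boolp classical_sets functions filter.
From mathcomp Require Import topology.

Set Implicit Arguments.
Unset Strict Implicit.
Unset Printing Implicit Defensive.

Local Open Scope classical_set_scope.
Local Open Scope group_scope.

(** Let [x] be a point of the closure of [G] in [H]. The traces on [G] of the
    neighbourhoods of [x] form a proper filter with a base of open sets. This
    filter is Cauchy: given a neighbourhood [V] of the unit of [H], a point [y]
    of [G] close enough to [x] has both [y^-1 * x] and [x * y^-1] in the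
    interior of [V] ([nbhs_divg]), so that [y * V] and [V * y] are
    neighbourhoods of [x] ([nbhs_lrtranslate]) and their traces belong to the
    filter ([trace_nbhs_group_cauchy]). Only translations by the single points [x] and [y]
    occur, which is why separate continuity of the product suffices. By
    completeness the trace filter has a cluster point [z] in [G]; in [H], the
    point [z] is then a cluster point of the neighbourhood filter of [x], and
    [z = x] because [H] is Hausdorff. Hence [x] belongs to [G]. *)

Section Trace.
Variables (S T : topologicalType) (f : S -> T).

Definition trace_nbhs (x : T) : set_system S :=
  filter_from (nbhs x) (fun W => f @^-1` W).

Lemma trace_nbhs_proper x : closure (range f) x -> ProperFilter (trace_nbhs x).
Proof.
move=> clx; apply: filter_from_proper.
  apply: filter_from_filter; first by exists setT; exact: filterT.
  by move=> A B nA nB; exists (A `&` B) => //; exact: filterI.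
by move=> W nW; have [_ [[s _ <-] Ws]] := clx _ nW; exists s.
Qed.

Lemma trace_nbhs_open_base x : continuous f ->
  exists2 B : set_system S,
    (forall O, B O -> open O) & trace_nbhs x = filter_from B id.
Proof.
move=> cf; exists [set f @^-1` W | W in open_nbhs x].
  by move=> _ [W [oW _] <-]; apply: open_comp => // s _; exact: cf.
apply/seteqP; split=> [A [W nW WA]|A [_ [W oW <-] WA]].
  move: nW; rewrite nbhsE => -[W' oW' W'W].
  by exists (f @^-1` W'); [exists W' | move=> s /W'W/WA].
by exists W => //; exact: open_nbhs_nbhs.
Qed.

(** A neighbourhood of [x] and one of [f z] have traces that meet, so they meet
    themselves. *)
Lemma cluster_trace_nbhs x z : hausdorff_space T -> continuous f ->
  cluster (trace_nbhs x) z -> x = f z.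
Proof.
move=> hT cf clz; apply: hT => A B nA nB.
have [s [As Bs]] : f @^-1` A `&` f @^-1` B !=set0.
  by apply: clz; [exists A | exact: cf].
by exists (f s).
Qed.

End Trace.

Section GroupMorphism.
Variables (G H : groupType) (f : {multiplicative G -> H}).

(** The structure of [f] records only compatibility with products; cancellation
    in [H] gives the rest. *)
Lemma multiplicative_group1 : f 1 = 1.
Proof. by apply: (@mulgI _ (f 1)); rewrite -gmulfM !mulg1. Qed.

Lemma multiplicative_groupV x : f x^-1 = (f x)^-1.
Proof.
apply: (@mulgI _ (f x)).
by rewrite -gmulfM !mulgV multiplicative_group1.
Qed.

End GroupMorphism.

Section Embedding.
Variables (G H : quasitopGroupType) (f : {multiplicative G -> H}).
Hypothesis femb : subgroup_embedding f.

Lemma subgroup_embedding_continuous : continuous f.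
Proof. by apply/continuousP => B oB; apply/femb.2; exists B. Qed.

Lemma subgroup_embedding_nbhs (z : G) (U : set G) : nbhs z U ->
  exists2 V : set H, nbhs (f z) V & f @^-1` V `<=` U.
Proof.
rewrite nbhsE => -[O [oO Oz] OU]; have [V oV OE] := (femb.2 O).1 oO.
exists V; last by rewrite -OE.
by apply: open_nbhs_nbhs; split=> //; rewrite OE in Oz.
Qed.

End Embedding.

Section Translations.
Variable H : quasitopGroupType.

Lemma nbhs_lrtranslate (y x : H) (V : set H) :
  nbhs (y^-1 * x) V -> nbhs (x * y^-1) V ->
  nbhs x [set w | V (y^-1 * w) /\ V (w * y^-1)].
Proof.
move=> Vl Vr; apply: filterI.
  exact: (@mulg_continuousl H y^-1 x V Vl).
exact: (@mulg_continuousr H y^-1 x V Vr).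
Qed.

(** At [y = x] both quotients are the unit, and both depend continuously on
    [y], being composites of the inversion with a translation. *)
Lemma nbhs_divg (x : H) (V : set H) : nbhs (1 : H) V ->
  nbhs x [set y | V (y^-1 * x) /\ V (x * y^-1)].
Proof.
move=> nV; apply: filterI.
  apply: (@invg_continuous H x [set u | V (u * x)]).
  by apply: (@mulg_continuousr H x x^-1 V); rewrite /= mulVg.
apply: (@invg_continuous H x [set u | V (x * u)]).
by apply: (@mulg_continuousl H x x^-1 V); rewrite /= mulgV.
Qed.

End Translations.

(** The points [y] of [G] with both quotients by [x] in an open [V] form a trace
    of a neighbourhood of [x]; for each of them, [y * V] and [V * y] are
    neighbourhoods of [x], whose traces are [y * U] and [U * y] when [U] is the
    trace of [V]. *)
Lemma trace_nbhs_group_cauchy (G H : quasitopGroupType)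
    (f : {multiplicative G -> H}) (x : H) :
  subgroup_embedding f -> group_cauchy (trace_nbhs f x).
Proof.
move=> femb U /(subgroup_embedding_nbhs femb)[V0].
(* [V] is taken open so that it is a neighbourhood of [y^-1 * x] and
   [x * y^-1], and not only of the unit. *)
rewrite multiplicative_group1 nbhsE => -[V [oV V1] VV0] V0U.
have nV u : V u -> nbhs u V by move=> Vu; exact: open_nbhs_nbhs.
exists (f @^-1` [set y | V (y^-1 * x) /\ V (x * y^-1)]).
  by eexists; last exact: subset_refl; apply/nbhs_divg/nV.
move=> y [/= /nV Vl /nV Vr].
exists [set w | V ((f y)^-1 * w) /\ V (w * (f y)^-1)].
  exact: nbhs_lrtranslate.
move=> g [/= Vyg Vgy]; split.
  exists (y^-1 * g); last by rewrite mulVKg.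
  by apply/V0U/VV0; rewrite /= gmulfM multiplicative_groupV.
exists (g * y^-1); last by rewrite mulgVK.
by apply/V0U/VV0; rewrite /= gmulfM multiplicative_groupV.
Qed.

Theorem proposition8 (G : quasitopGroupType) :
  hausdorff_space G -> cauchy_completty G ->
  h_closed_in (fun H : quasitopGroupType => hausdorff_space H) G.
Proof.
move=> _ complG H f hH femb x clx.
have cf := subgroup_embedding_continuous femb.
have [z clz] := complG _ (trace_nbhs_proper clx)
  (trace_nbhs_group_cauchy x femb) (trace_nbhs_open_base x cf).
by exists z => //; rewrite (cluster_trace_nbhs hH cf clz).
Qed.
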